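(* Let $f:\Omega\subseteq\mathbb{R}^d\to\mathbb{R}$ and a probability density $\pi$ on $\mathbb{R}^d$ satisfy: (i) $f$ is continuous with a finite global minimum value $f^*$, i.e. $f(x)\geq f^*$ for all $x\in\Omega$; (ii) the set of global minima $\Omega^*=\{x\in\Omega: f(x)=f^*\}$ is non-empty; (iii) $\pi(x)>0$ for every $x\in\mathbb{R}^d$ and $\int_{\mathbb{R}^d}\pi(x)\,dx=1$. Let $m_k$ denote the nascent minima distribution density associated with $f$ and $\pi$. Then $$\lim_{k\to\infty}\int_{\Omega} f(x)\,m_k(x)\,dx=f^*.$$
   Context: All integrals are with respect to Lebesgue measure on $\mathbb{R}^d$. For $k\geq 0$ the nascent minima distribution density is $$m_k(x)=\frac{e^{-kf(x)}\,\pi(x)}{\int_{\Omega}e^{-kf(t)}\,\pi(t)\,dt},\qquad x\in\Omega,$$ where $\Omega\subseteq\mathbb{R}^d$ is (measurable and) such that the denominator is a finite positive quantity for every $k\geq 0$.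
   Formalization: Added assumption: some global minimum x in Ω* has every neighbourhood meeting Ω in positive Lebesgue measure. Without it the claim fails, e.g. for Ω = {0} ∪ [1,2], f(x) = min(|x|,1), where the integral is 1 for all k but f* = 0. *)

(* Defs.v *)
From HB Require Import structures.
From mathcomp Require Import all_boot all_order all_algebra.
From mathcomp Require Import all_classical all_reals all_analysis.

Set Implicit Arguments.
Unset Strict Implicit.
Unset Printing Implicit Defensive.

Import Order.TTheory GRing.Theory Num.Theory.
Import numFieldNormedType.Exports.

Local Open Scope classical_set_scope.
Local Open Scope ring_scope.

Section lebesgue_rV.
Context (R : realType) (d : nat).
Implicit Types (X : set 'rV[R]_d) (p : option ('rV[R]_d * 'rV[R]_d)).

(* [Some (a, b)] encodes the half-open box of points x with
   a_i < x_i <= b_i for all i.  [None] is the empty set, so that finite covers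
   are countable covers also when d = 0, where every box has volume 1. *)
Definition box p : set 'rV[R]_d :=
  if p is Some (a, b) then [set x | forall i, a 0 i < x 0 i <= b 0 i]
  else set0.

Definition box_volume p : R :=
  if p is Some (a, b) then \prod_(i < d) Num.max 0 (b 0 i - a 0 i) else 0.

Definition box_cover X : set (nat -> option ('rV[R]_d * 'rV[R]_d)) :=
  [set B | X `<=` \bigcup_k box (B k)].

Local Open Scope ereal_scope.

Definition lebesgue_outer X : \bar R :=
  ereal_inf [set \sum_(k <oo) (box_volume (B k))%:E | B in box_cover X].

Lemma box_volume_ge0 p : 0 <= (box_volume p)%:E.
Proof.
case: p => [[a b]|] /=; last by [].
by rewrite lee_fin; apply: prodr_ge0 => i _; rewrite le_max lexx.
Qed.

Lemma lebesgue_outer_ge0 X : 0 <= lebesgue_outer X.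
Proof.
apply: le_ereal_inf_tmp => _ [B _ <-].
by apply: nneseries_ge0 => k _ _; exact: box_volume_ge0.
Qed.

Lemma lebesgue_outer0 : lebesgue_outer set0 = 0.
Proof.
apply/eqP; rewrite eq_le lebesgue_outer_ge0 andbT.
apply: ereal_inf_lbound; exists (fun=> None); first exact: sub0set.
by rewrite eseries0.
Qed.

Lemma le_lebesgue_outer :
  {homo lebesgue_outer : X Y / X `<=` Y >-> X <= Y}.
Proof.
move=> X Y XY; apply: ereal_inf_le_tmp => _ [B YB <-].
by exists B => //; exact: subset_trans XY YB.
Qed.

Lemma lebesgue_outer_sigma_subadditive : sigma_subadditive lebesgue_outer.
Proof.
move=> A; have [[i ioo]|] := pselect (exists i, lebesgue_outer (A i) = +oo).
  rewrite (eseries_pinfty _ _ ioo) ?leey// => n _.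
  by rewrite -ltNye (lt_le_trans _ (lebesgue_outer_ge0 _)).
rewrite -forallNE => Aoo.
suff add2e (e : {posnum R}) : lebesgue_outer (\bigcup_n A n) <=
    \sum_(i <oo) lebesgue_outer (A i) + e%:num%:E.
  by apply/lee_addgt0Pr => _/posnumP[].
rewrite (le_trans _ (epsilon_trick _ _ _))//; last first.
  by move=> n; exact: lebesgue_outer_ge0.
pose P n B := box_cover (A n) B /\
  \sum_(k <oo) (box_volume (B k))%:E <=
    lebesgue_outer (A n) + (e%:num / (2 ^ n.+1)%:R)%:E.
have [G PG] : {G & forall n, P n (G n)}.
  apply: (@choice _ _ P) => n; rewrite /P /lebesgue_outer.
  set S := (X in ereal_inf X); move infS : (ereal_inf S) => iS.
  case: iS infS => [r Sr|Soo|Soo].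
  - have en1 : (0 < e%:num / (2 ^ n.+1)%:R)%R by [].
    have /(lb_ereal_inf_adherent en1) : ereal_inf S \is a fin_num by rewrite Sr.
    move=> [x [B AnB muBx] xS].
    by exists B; split => //; rewrite muBx -Sr; exact/ltW.
  - by have := Aoo n; rewrite /lebesgue_outer Soo.
  - suff : lbound S 0 by move/le_ereal_inf_tmp; rewrite Soo.
    move=> /= _ [B AnB <-].
    by apply: nneseries_ge0 => k _ _; exact: box_volume_ge0.
pose w x := (box_volume (uncurry G x))%:E.
have w_ge0 x : 0 <= w x by exact: box_volume_ge0.
apply: (@le_trans _ _ (\esum_(i in setT) w i)).
  apply: ereal_inf_lbound => /=.
  have /card_esym/ppcard_eqP[f] := card_nat2.
  exists (uncurry G \o f).
    move=> t [i _ /(PG i).1 [j _ Bijt]]; exists (f^-1%FUN (i, j)) => //=.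
    by rewrite invK ?inE.
  rewrite -(esum_pred_image w _ xpredT) ?[fun=> _]set_true//.
  by rewrite image_eq.
rewrite (_ : esum _ _ = \sum_(i <oo) \sum_(j <oo) w (i, j)); last first.
  pose J : nat -> set (nat * nat) := fun i => [set (i, j) | j in setT].
  rewrite (_ : setT = \bigcup_k J k); last first.
    by rewrite predeqE => -[a b]; split => // _; exists a => //; exists b.
  rewrite esum_bigcupT /=; last 2 first.
    - apply/trivIsetP => i j _ _ ij.
      rewrite predeqE => -[n m] /=; split => //= -[] [_] _ [<-{n} _].
      by move=> [m' _] [] /esym/eqP; rewrite (negbTE ij).
    - by move=> /= [n m]; exact: w_ge0.
  rewrite -(image_id [set: nat]) -fun_true esum_pred_image//; last first.
    by move=> n _; exact: esum_ge0.
  apply: eq_eseriesr => /= j _.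
  rewrite -(esum_pred_image w (pair j) predT)//=; last first.
    by move=> ? ? _ _; exact: (@can_inj _ _ _ snd).
  by congr esum; rewrite predeqE => -[a b]; split; move=> [i _ <-]; exists i.
apply: lee_lim.
- apply: is_cvg_nneseries => n *.
  by apply: nneseries_ge0 => m *; exact: (w_ge0 (n, m)).
- apply: is_cvg_nneseries => n *; apply: adde_ge0 => //.
  exact: lebesgue_outer_ge0.
- by near=> n; apply: lee_sum => i _; exact: (PG i).2.
Unshelve. all: by end_near. Qed.

HB.instance Definition _ := isOuterMeasure.Build R 'rV[R]_d lebesgue_outer
  lebesgue_outer0 lebesgue_outer_ge0 le_lebesgue_outer
  lebesgue_outer_sigma_subadditive.

(* Measurable sets are the Lebesgue (Caratheodory) measurable sets, not only the
   Borel sets. *)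
Definition lebesgue_rV : set (caratheodory_type lebesgue_outer) -> \bar R :=
  lebesgue_outer.

HB.instance Definition _ := isMeasure.Build _ _ _ lebesgue_rV
  lebesgue_outer0 lebesgue_outer_ge0
  (@caratheodory_measure_sigma_additive _ _ lebesgue_outer).

End lebesgue_rV.

Arguments lebesgue_rV {R d}.

Notation lebesgue_rV_type R d := (caratheodory_type (@lebesgue_outer R d)).

Section nascent_minima_distribution.
Context (R : realType) (d : nat).
Implicit Types (Omega : set 'rV[R]_d) (f pi : 'rV[R]_d -> R).

Definition global_minima Omega f (fstar : R) : set 'rV[R]_d :=
  [set x | Omega x /\ f x = fstar].

Definition nascent_mass Omega f pi (k : R) : \bar R :=
  (\int[lebesgue_rV]_(x in Omega) (expR (- (k * f x)) * pi x)%:E)%E.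

(* The value is only meaningful for x in Omega and a finite positive mass. *)
Definition nascent_density Omega f pi (k : R) (x : 'rV[R]_d) : R :=
  expR (- (k * f x)) * pi x / fine (nascent_mass Omega f pi k).

End nascent_minima_distribution.

(* Main.v *)
Require Import Defs.
From mathcomp Require Import all_boot all_order all_algebra.
From mathcomp Require Import all_classical all_reals all_analysis.
From mathcomp Require Import measurable_realfun ring lra.

Import Order.TTheory GRing.Theory Num.Theory.
Import numFieldNormedType.Exports.

Local Open Scope classical_set_scope.
Local Open Scope ring_scope.

(** Put [g = f - fstar >= 0].  The mean of [f] under the density proportional to
    [expR (- (k * f)) * pi] is [fstar] plus the mean of [g], so it suffices that
    the latter tends to 0.  For [k >= 1] and [e > 0], every point of the domain
    satisfies
      [g * expR (- (k * g)) <= e * expR (- (k * g)) + expR (- ((k - 1) * e))]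
    (lemma [gibbs_excess_le]).  Integrating against [pi] and dividing by the mass
    bounds the mean of [g] by [e] plus [expR (- ((k - 1) * e))] over the mass
    [\int expR (- (k * g)) * pi].  That mass is at least
    [A * expR (- (k * (e / 2)))], where [A] is the [pi]-mass of the set where
    [g < e / 2] (lemma [gibbs_mass_ge]), so the second term decays like
    [expR (- (k * (e / 2)))] as soon as [A > 0] (lemmas [gibbs_mean_bound] and
    [gibbs_mean_cvg]).

    These arguments hold over any measure.  In the Euclidean case [A > 0] because
    [g < e / 2] on a relative neighbourhood of a minimiser all of whose relative
    neighbourhoods have positive measure, and [pi] is positive.  Measurability
    of [f] comes from its continuity once open sets are known to be measurable
    for the outer measure built from boxes: half-spaces satisfy the Caratheodory
    condition because a hyperplane cuts a box into two boxes whose volumes add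
    up, and open sets are countable unions of boxes. *)

(** * Integrals of real-valued functions *)

Lemma ge0_le_integrable d (T : measurableType d) (R : realType)
    (mu : {measure set T -> \bar R}) (D : set T) (g h : T -> R) :
  measurable D -> measurable_fun D g ->
  (forall x, D x -> 0 <= g x <= h x) ->
  mu.-integrable D (EFin \o h) -> mu.-integrable D (EFin \o g).
Proof.
move=> mD mg gh; apply: le_integrable => //; first exact/measurable_EFinP.
move=> x Dx /=; have /andP[g0 le_gh] := gh x Dx.
by rewrite lee_fin !ger0_norm// (le_trans g0).
Qed.

Lemma integrable_EFinD d (T : measurableType d) (R : realType)
    (mu : {measure set T -> \bar R}) (D : set T) (g h : T -> R) :
  measurable D -> mu.-integrable D (EFin \o g) ->
  mu.-integrable D (EFin \o h) ->
  mu.-integrable D (EFin \o (fun x => g x + h x)).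
Proof. by move=> mD ig ih; exact: (integrableD mD ig ih). Qed.

Lemma integrable_EFinZl d (T : measurableType d) (R : realType)
    (mu : {measure set T -> \bar R}) (D : set T) (a : R) (g : T -> R) :
  measurable D -> mu.-integrable D (EFin \o g) ->
  mu.-integrable D (EFin \o (fun x => a * g x)).
Proof. by move=> mD ig; exact: (integrableZl mD a ig). Qed.

Lemma integral_gt0 d (T : measurableType d) (R : realType)
    (mu : {measure set T -> \bar R}) (E : set T) (g : T -> R) :
  measurable E -> measurable_fun E g -> (forall x, E x -> 0 < g x) ->
  (0 < mu E)%E -> (0 < \int[mu]_(x in E) (g x)%:E)%E.
Proof.
move=> mE mg g0 muE; rewrite lt_neqAle integral_ge0 ?andbT; last first.
  by move=> x Ex; rewrite lee_fin ltW ?g0.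
apply/eqP => int0.
have /(ae_eq_integral_abs mu mE) : (\int[mu]_(x in E) `|(g x)%:E| = 0)%E.
  rewrite int0; apply: eq_integral => x /set_mem Ex.
  by rewrite /= ger0_norm// ltW ?g0.
case=> [|N [mN N0 sub]]; first exact/measurable_EFinP.
suff /(subset_measure0 mE mN)/(_ N0) E0 : E `<=` N by rewrite E0 ltxx in muE.
move=> x Ex; apply: sub => /= /(_ Ex) [gx0].
by have := g0 x Ex; rewrite gx0 ltxx.
Qed.

(** * Concentration of Gibbs averages *)

(** The pointwise estimate behind the concentration, with [p] the density at a
    point.  Where the excess [g = f - c] is at most [eps] the first term on the
    right dominates.  Elsewhere [g <= expR g], so that
    [g * expR (- (k * g)) <= expR (- ((k - 1) * g))], which decreases in [g]:
    one factor [expR (- g)] is spent to absorb the possibly unbounded [f]. *)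
Lemma gibbs_excess_le (R : realType) (c f p k eps : R) :
  0 < eps -> 0 <= p -> c <= f -> 1 <= k ->
  (f - c) * (expR (- (k * f)) * p) <=
  eps * (expR (- (k * f)) * p) + expR (- ((k - 1) * eps + k * c)) * p.
Proof.
move=> e0 p0 cf k1; rewrite !mulrA -mulrDl; apply: ler_wpM2r => //.
have [le|lt] := leP (f - c) eps.
  by rewrite ler_wpDr ?expR_ge0// ler_wpM2r ?expR_ge0.
apply: ler_wpDl; first by rewrite mulr_ge0 ?expR_ge0// ltW.
have gexp : f - c <= expR (f - c) by have := expR_ge1Dx (f - c); lra.
apply: (le_trans (ler_wpM2r (expR_ge0 _) gexp)).
rewrite -expRD ler_expR; nra.
Qed.

Section gibbs_mean.
Context d (T : measurableType d) (R : realType).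
Context (mu : {measure set T -> \bar R}) (D : set T) (f p : T -> R) (c : R)
  (mD : measurable D)
  (mf : measurable_fun D f)
  (ip : mu.-integrable D (EFin \o p))
  (p0 : forall x, D x -> 0 <= p x)
  (cf : forall x, D x -> c <= f x).

Local Notation w k := (fun x => expR (- (k * f x)) * p x).

Let mp : measurable_fun D p.
Proof. by apply/measurable_EFinP; exact: measurable_int ip. Qed.

Lemma measurable_gibbs_weight k : measurable_fun D (w k).
Proof.
apply: measurable_funM => //; apply: measurableT_comp => //.
by apply: measurableT_comp => //; apply: measurable_funM.
Qed.

Let wk := measurable_gibbs_weight.

Let w_ge0 k x : D x -> 0 <= w k x.
Proof. by move=> Dx; rewrite mulr_ge0 ?expR_ge0 ?p0. Qed.

Lemma integrable_gibbs_weight k : 0 <= k -> mu.-integrable D (EFin \o w k).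
Proof.
move=> k0; apply: (@ge0_le_integrable _ _ _ _ _ _
  (fun x => expR (- (k * c)) * p x)) => //.
  move=> x Dx; rewrite w_ge0//=.
  by rewrite ler_wpM2r ?p0// ler_expR lerN2 ler_wpM2l ?cf.
exact: integrable_EFinZl.
Qed.

(** Although [f] may be unbounded, the pointwise bound with [eps = 1] gives an
    integrable dominating function. *)
Lemma integrable_gibbs_excess k : 1 <= k ->
  mu.-integrable D (EFin \o (fun x => (f x - c) * w k x)).
Proof.
move=> k1; have k0 : 0 <= k by lra.
apply: (@ge0_le_integrable _ _ _ _ _ _ (fun x => 1 * w k x +
  expR (- ((k - 1) * 1 + k * c)) * p x)) => //.
- by apply: measurable_funM => //; exact: measurable_funB.
- move=> x Dx; rewrite mulr_ge0 ?w_ge0 ?subr_ge0 ?cf//=.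
  by apply: gibbs_excess_le; rewrite ?p0 ?cf.
have iw := integrable_gibbs_weight _ k0.
by apply: integrable_EFinD => //; exact: integrable_EFinZl.
Qed.

Let S e := D `&` [set x | f x < c + e].

Let mS e : measurable (S e).
Proof.
rewrite /S (_ : [set x | _] = f @^-1` `]-oo, c + e[%classic).
  exact: mf.
by apply/seteqP; split=> x /=; rewrite in_itv.
Qed.

Let ipS e : mu.-integrable (S e) (EFin \o p).
Proof. by apply: integrableS ip => // x []. Qed.

(** Keep only the points where [f < c + e]: there the exponential factor is at
    least [expR (- (k * (c + e)))]. *)
Lemma gibbs_mass_ge k e : 0 <= k ->
  expR (- (k * (c + e))) * \int[mu]_(x in S e) p x <= \int[mu]_(x in D) w k x.
Proof.
move=> k0; rewrite -RintegralZl//.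
apply: (@le_trans _ _ (\int[mu]_(x in S e) w k x)).
  apply: le_Rintegral => //.
  - exact: integrable_EFinZl.
  - by apply: integrableS (integrable_gibbs_weight _ k0) => // x [].
  - move=> x [Dx /= fx]; rewrite ler_wpM2r ?p0// ler_expR lerN2.
    by rewrite ler_wpM2l// ltW.
rewrite /Rintegral fine_le//.
- apply: integrable_fin_num => //.
  by apply: integrableS (integrable_gibbs_weight _ k0) => // x [].
- exact/integrable_fin_num/integrable_gibbs_weight.
- apply: ge0_subset_integral => //.
  + exact/measurable_EFinP.
  + by move=> x Dx; rewrite lee_fin w_ge0.
  + by move=> x [].
Qed.

Context (p_near_min :
  forall e, 0 < e -> (0 < \int[mu]_(x in S e) (p x)%:E)%E).

(** The normalised excess [r] is controlled by integrating the pointwise bound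
    with [eps = e].  After division by the mass, its first term contributes [e]
    and its second a ratio of exponentials, in which the mass is bounded below
    with the smaller level [e / 2], so that a factor [expR (- (k * (e / 2)))]
    survives. *)
Lemma gibbs_mean_bound k e : 1 <= k -> 0 < e ->
  exists2 r, 0 <= r <= e + expR e * \int[mu]_(x in D) p x /
      \int[mu]_(x in S (e / 2)) p x * expR (- (k * (e / 2))) &
  (\int[mu]_(x in D) (f x * (w k x /
     fine (\int[mu]_(y in D) (w k y)%:E)))%:E = (c + r)%:E)%E.
Proof.
move=> k1 e0; have k0 : 0 <= k by lra.
have iw := integrable_gibbs_weight _ k0.
have ig := integrable_gibbs_excess _ k1.
have A0 : 0 < \int[mu]_(x in S (e / 2)) p x.
  rewrite fine_gt0// p_near_min ?divr_gt0//=.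
  by rewrite ltey_eq (integrable_fin_num _ (ipS _)).
have P0 : 0 <= \int[mu]_(x in D) p x by exact: Rintegral_ge0.
have Zge := gibbs_mass_ge _ (e / 2) k0.
(* [fine] of the mass is by definition the real-valued integral. *)
rewrite -/(Rintegral mu D (w k)).
set A := \int[mu]_(x in S _) p x in A0 Zge *.
set P := \int[mu]_(x in D) p x in P0 *.
set Z := \int[mu]_(x in D) w k x in Zge *.
have Z0 : 0 < Z by apply: lt_le_trans Zge; rewrite mulr_gt0 ?expR_gt0.
pose G := \int[mu]_(x in D) ((f x - c) * w k x).
have G0 : 0 <= G.
  by apply: Rintegral_ge0 => x Dx; rewrite mulr_ge0 ?w_ge0// subr_ge0 cf.
have Gle : G <= e * Z + expR (- ((k - 1) * e + k * c)) * P.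
  rewrite -!RintegralZl// -RintegralD//; last 2 first.
  - exact: integrable_EFinZl.
  - exact: integrable_EFinZl.
  apply: le_Rintegral => //.
    by apply: integrable_EFinD => //; exact: integrable_EFinZl.
  by move=> x Dx; apply: gibbs_excess_le; rewrite ?p0 ?cf.
exists (G / Z).
  rewrite divr_ge0 ?(ltW Z0)//= ler_pdivrMr// mulrDl.
  apply: (le_trans Gle); rewrite lerD2l.
  apply: (@le_trans _ _ (expR e * P / A * expR (- (k * (e / 2))) *
    (expR (- (k * (c + e / 2))) * A))); last first.
    by rewrite ler_wpM2l// !mulr_ge0 ?invr_ge0 ?expR_ge0// ltW.
  have -> : expR e * P / A * expR (- (k * (e / 2))) *
    (expR (- (k * (c + e / 2))) * A) =
    (expR e * expR (- (k * (e / 2))) * expR (- (k * (c + e / 2)))) * P.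
    by field; rewrite gt_eqF.
  rewrite -!expRD ler_wpM2r// ler_expR; lra.
pose h x := Z^-1 * ((f x - c) * w k x + c * w k x).
have igw : mu.-integrable D (EFin \o (fun x => (f x - c) * w k x + c * w k x)).
  by apply: integrable_EFinD => //; exact: integrable_EFinZl.
have ih : mu.-integrable D (EFin \o h) by exact: integrable_EFinZl.
transitivity (\int[mu]_(x in D) (h x)%:E)%E.
  by apply: eq_integral => x _; congr EFin; rewrite /h; ring.
rewrite -[LHS]fineK ?(integrable_fin_num mD ih)//; congr EFin.
rewrite -/(Rintegral mu D h) RintegralZl// RintegralD//; last first.
  exact: integrable_EFinZl.
rewrite RintegralZl// -/G -/Z; field; by rewrite gt_eqF.
Qed.

(** Laplace's principle over an arbitrary measure.  The last hypothesis makes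
    [c] the essential infimum of [f] for the measure of density [p], and the
    bound on the excess then becomes [e] plus a term vanishing as [k] grows,
    for every [e > 0]. *)
Lemma gibbs_mean_cvg :
  (\int[mu]_(x in D) (f x * (w k x /
     fine (\int[mu]_(y in D) (w k y)%:E)))%:E)%E @[k --> +oo] --> c%:E.
Proof.
apply: cvg_EFin.
  near=> k; have k1 : 1 <= k by near: k; apply: nbhs_pinfty_ge; rewrite num_real.
  by have [r _ ->] := gibbs_mean_bound _ _ k1 ltr01.
apply/cvgrPdist_le => eps eps0.
have e0 : 0 < eps / 2 by rewrite divr_gt0.
set e := eps / 2 in e0 *.
pose C := expR e * \int[mu]_(x in D) p x / \int[mu]_(x in S (e / 2)) p x.
have C0 : 0 <= C.
  rewrite !mulr_ge0 ?expR_ge0 ?invr_ge0//; apply: Rintegral_ge0 => // x [Dx _].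
  exact: p0.
near=> k; have k1 : 1 <= k by near: k; apply: nbhs_pinfty_ge; rewrite num_real.
have [r /andP[r0 rle] /= ->] := gibbs_mean_bound _ _ k1 e0; rewrite -/C in rle.
have kC : C / (e * (e / 2)) <= k.
  by near: k; apply: nbhs_pinfty_ge; rewrite num_real.
rewrite /= opprD addrA subrr add0r normrN ger0_norm// (le_trans rle)//.
(* As [expR t >= 1 + t], [kC] makes [C * expR (- (k * (e / 2)))] small. *)
rewrite [leRHS](_ : _ = e + e); last by rewrite /e; lra.
rewrite lerD2l expRN ler_pdivrMr ?expR_gt0//.
move: kC; rewrite ler_pdivrMr ?mulr_gt0 ?divr_gt0// => kC.
have := expR_ge1Dx (k * (e / 2)); nra.
Unshelve. all: by end_near. Qed.

End gibbs_mean.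

(** * Open sets are Caratheodory measurable *)

Section open_measurable.
Context (R : realType) (d : nat).
Implicit Types (p : option ('rV[R]_d * 'rV[R]_d)) (U Omega : set 'rV[R]_d).

(** [cut_le i c p] and [cut_gt i c p] are the two pieces into which the
    hyperplane [x 0 i = c] cuts the box [p].  Replacing the bound by a minimum
    or maximum also covers a hyperplane missing the box: one piece is then
    empty. *)
Definition cut_le (i : 'I_d) (c : R) p : option ('rV[R]_d * 'rV[R]_d) :=
  if p is Some (a, b) then
    Some (a, \row_j if j == i then Num.min (b 0 j) c else b 0 j)
  else None.

Definition cut_gt (i : 'I_d) (c : R) p : option ('rV[R]_d * 'rV[R]_d) :=
  if p is Some (a, b) then
    Some (\row_j if j == i then Num.max (a 0 j) c else a 0 j, b)
  else None.

Lemma box_cut_le i c p : box p `&` [set x | x 0 i <= c] `<=` box (cut_le i c p).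
Proof.
case: p => [[a b]|] x [] //= abx xc j; rewrite mxE.
by case: eqP => [->|_]; rewrite ?le_min ?xc ?andbT abx.
Qed.

Lemma box_cut_gt i c p :
  box p `&` ~` [set x | x 0 i <= c] `<=` box (cut_gt i c p).
Proof.
case: p => [[a b]|] x [] //= abx /negP; rewrite -ltNge => xc j; rewrite mxE.
by case: eqP => [->|_]; rewrite ?gt_max ?xc ?andbT abx.
Qed.

(** Only the [i]-th side is cut, and its truncated length splits additively in
    every position of [c]. *)
Lemma box_volume_cut i c p :
  box_volume p = box_volume (cut_le i c p) + box_volume (cut_gt i c p).
Proof.
case: p => [[a b]|] /=; last by rewrite addr0.
have vol (u v : 'rV[R]_d) : \prod_(j < d) Num.max 0 (v 0 j - u 0 j) =
    Num.max 0 (v 0 i - u 0 i) *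
    \prod_(j < d | j != i) Num.max 0 (v 0 j - u 0 j).
  by rewrite (bigD1 i).
rewrite !vol.
rewrite !mxE eqxx.
under [X in _ = _ * X + _]eq_bigr => j ji do rewrite mxE (negbTE ji).
under [X in _ = _ + _ * X]eq_bigr => j ji do rewrite mxE (negbTE ji).
rewrite -mulrDl; congr (_ * _).
rewrite !maxEle !minEle; do ?case: ifPn; move: (a 0 i) (b 0 i) => u v;
  rewrite -?ltNge; lra.
Qed.

(** Cutting every box of a cover of [X] yields covers of both parts of [X] with
    the same total volume, which is the Caratheodory condition. *)
Lemma measurable_half_space (i : 'I_d) (c : R) :
  measurable ([set x | x 0 i <= c] : set (lebesgue_rV_type R d)).
Proof.
apply: le_caratheodory_measurable => X.
apply: le_ereal_inf_tmp => _ [B XB <-].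
under eq_eseriesr => k _ do rewrite (box_volume_cut i c) EFinD.
rewrite nneseriesD; [|by move=> *; exact: box_volume_ge0..].
apply: leeD; apply: ereal_inf_lbound.
- exists (cut_le i c \o B) => // x [Xx xc].
  have [k _ Bkx] := XB x Xx.
  by exists k => //; apply: box_cut_le.
- exists (cut_gt i c \o B) => // x [Xx xc].
  have [k _ Bkx] := XB x Xx.
  by exists k => //; apply: box_cut_gt.
Qed.

Lemma measurable_box p : measurable (box p : set (lebesgue_rV_type R d)).
Proof.
case: p => [[a b]|]; last exact: measurable0.
have -> : box (Some (a, b)) = \bigcap_i
    (~` [set x : 'rV[R]_d | x 0 i <= a 0 i] `&` [set x | x 0 i <= b 0 i]).
  apply/seteqP; split => x /= abx i.
    by have /andP[ax xb] := abx i; split => //=; apply/negP; rewrite -ltNge.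
  by have [/negP + ->] := abx i I; rewrite andbT -ltNge.
apply: fin_bigcap_measurable => // i _.
apply: measurableI; last exact: measurable_half_space.
by apply: measurableC; exact: measurable_half_space.
Qed.

(** An open set is the union of the boxes with rational corners that it
    contains, and there are countably many of these. *)
Lemma measurable_open_rV U :
  open U -> measurable (U : set (lebesgue_rV_type R d)).
Proof.
move=> oU.
pose Q (q : 'rV[rat]_d * 'rV[rat]_d) : set 'rV[R]_d :=
  box (Some (map_mx ratr q.1, map_mx ratr q.2)).
have -> : U = \bigcup_q (if `[< Q q `<=` U >] then Q q else set0).
  apply/seteqP; split => [x Ux|x [q _]]; last by case: asboolP => // + ?; exact.
  have [e /= e0 xeU] : nbhs_ball x U.
    by apply/nbhs_ballP; move: oU; rewrite openE => /(_ _ Ux).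
  have [a ax] : {a : 'I_d -> rat & forall i, x 0 i - e < ratr (a i) < x 0 i}.
    apply: (@choice _ _ (fun i (q : rat) => x 0 i - e < ratr q < x 0 i)) => i.
    have [|q] := @rat_in_itvoo R (x 0 i - e) (x 0 i); first by lra.
    by rewrite in_itv/=; exists q.
  have [b xb] : {b : 'I_d -> rat & forall i, x 0 i < ratr (b i) < x 0 i + e}.
    apply: (@choice _ _ (fun i (q : rat) => x 0 i < ratr q < x 0 i + e)) => i.
    have [|q] := @rat_in_itvoo R (x 0 i) (x 0 i + e); first by lra.
    by rewrite in_itv/=; exists q.
  exists (\row_i a i, \row_i b i) => //.
  case: asboolP => [_ i|[]] /=.
    by rewrite !mxE; have := ax i; have := xb i; lra.
  move=> y Qy; apply: xeU; split => // i j; rewrite (ord1 i) /ball/= ltr_norml.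
  have := Qy j; rewrite !mxE; have := ax j; have := xb j; lra.
apply: countable_bigcupT_measurable => [|q]; first exact: countableP.
by case: asboolP => _; [exact: measurable_box|exact: measurable0].
Qed.

Lemma continuous_measurable_rV Omega (f : 'rV[R]_d -> R) :
  measurable (Omega : set (lebesgue_rV_type R d)) ->
  {within Omega, continuous f} ->
  measurable_fun (Omega : set (lebesgue_rV_type R d)) f.
Proof.
move=> mO /continuousP cf; apply: (measurability _ (RGenOpens.measurableE R)).
move=> _ [_ [a [b ->] <-]].
have /open_subspaceP[V oV VO] :=
  cf _ (@interval_open R (BRight a) (BLeft b) isT isT).
rewrite setIC -VO.
by apply: measurableI => //; exact: measurable_open_rV.
Qed.

End open_measurable.

(** * The nascent minima distribution *)

Theorem theorem1 (R : realType) (d : nat) (Omega : set 'rV[R]_d)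
    (f pi : 'rV[R]_d -> R) (fstar : R)
    (Omega_measurable : measurable (Omega : set (lebesgue_rV_type R d)))
    (mass_gt0_finite : forall k : R, 0 <= k ->
      (0 < nascent_mass Omega f pi k < +oo)%E)
    (f_continuous : {within Omega, continuous f})
    (f_ge_fstar : forall x, Omega x -> fstar <= f x)
    (minima_nonempty : global_minima Omega f fstar !=set0)
    (* Without this the claim fails, e.g. for Omega = {0} `|` [1, 2] and
       f x = min |x| 1. *)
    (minimum_not_locally_null : exists2 x, global_minima Omega f fstar x &
      forall U : set 'rV[R]_d, open U -> U x ->
        (0 < lebesgue_rV (Omega `&` U))%E)
    (pi_measurable : measurable_fun [set: lebesgue_rV_type R d] pi)
    (pi_gt0 : forall x, 0 < pi x)
    (pi_integral : (\int[lebesgue_rV]_x (pi x)%:E = 1)%E) :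
  (\int[lebesgue_rV]_(x in Omega)
     (f x * nascent_density Omega f pi k x)%:E)%E @[k --> +oo]
    --> fstar%:E.
Proof.
have mf := continuous_measurable_rV _ _ _ f Omega_measurable f_continuous.
have mpi : measurable_fun (Omega : set (lebesgue_rV_type R d)) pi.
  exact: measurable_funS pi_measurable.
have ipi : lebesgue_rV.-integrable Omega (EFin \o pi).
  apply: (@integrableS _ _ _ _ setT) => //; apply/integrableP; split.
    exact/measurable_EFinP.
  under eq_integral => x _ do rewrite /= ger0_norm ?ltW//.
  by rewrite pi_integral ltry.
apply: gibbs_mean_cvg => //= [x _|e e0]; first exact: ltW.
have [x0 [Ox0 fx0] x0_full] := minimum_not_locally_null.
have /continuousP/(_ _ (@open_lt R (fstar + e)))/open_subspaceP[V oV VO] :=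
  f_continuous.
have -> : Omega `&` [set x | f x < fstar + e] = Omega `&` V.
  by rewrite setIC -VO setIC.
have mOV : measurable (Omega `&` V : set (lebesgue_rV_type R d)).
  by apply: measurableI => //; exact: measurable_open_rV.
apply: integral_gt0 => //; first exact: measurable_funS mpi.
apply: x0_full => //.
suff : (V `&` Omega) x0 by case.
by rewrite VO; split => //=; rewrite /from_subspace fx0 ltrDl.
Qed.
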